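(* Let $H=(V,E)$ be a finite hypergraph and let $\mathcal{F}=(V',F)$ with $V'\subseteq V$, $F\subseteq E$ be a hyperforest contained in $H$. Then $\mathcal{F}$ has at most $|V|-1$ hyperedges, i.e. $|F|\le |V|-1$.
   Context: A hypergraph $H=(V,E)$ has a finite vertex set $V$ and a set $E$ of nonempty subsets of $V$ (hyperedges). For a hypergraph $(V',E')$ and $X\subseteq V'$, $\Gamma(X)$ denotes the set of edges $e\in E'$ with $e\cap X\neq\emptyset$. A hypergraph $(V',E')$ is a hypercircuit if $|V'|=|E'|$ and $|\Gamma(X)|\ge |X|+1$ for every nonempty proper subset $X\subsetneq V'$. A hypergraph is a hyperforest if it contains no sub-hypergraph that is a hypercircuit. *)

(* Defs.v *)
From mathcomp Require Import all_boot.

Set Implicit Arguments.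
Unset Strict Implicit.
Unset Printing Implicit Defensive.

(* The vertex set is an arbitrary subset of the ambient finite type, so that a
   hypergraph and its sub-hypergraphs live over the same type. *)
Record hypergraph (T : finType) := Hypergraph {
  vertices : {set T};
  edges : {set {set T}};
  edgesP : forall e, e \in edges -> e != set0 /\ e \subset vertices }.

(* As C is itself a hypergraph, its edges lie inside [vertices C]: a
   sub-hypergraph keeps whole edges of G, never their traces. *)
Definition subhypergraph (T : finType) (C G : hypergraph T) : Prop :=
  vertices C \subset vertices G /\ edges C \subset edges G.

Definition Gamma (T : finType) (G : hypergraph T) (X : {set T}) : {set {set T}} :=
  [set e in edges G | e :&: X != set0].

(* Without the nonemptiness clause the hypergraph with no vertices and no edges
   would vacuously be a hypercircuit; as it is contained in every hypergraph,
   there would be no hyperforest at all. *)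
Definition hypercircuit (T : finType) (C : hypergraph T) : Prop :=
  [/\ vertices C != set0,
      #|vertices C| = #|edges C|
    & forall X : {set T}, X != set0 -> X \proper vertices C ->
        #|X| + 1 <= #|Gamma C X| ].

Definition hyperforest (T : finType) (F : hypergraph T) : Prop :=
  forall C : hypergraph T, subhypergraph C F -> ~ hypercircuit C.

(* Main.v *)
(** Among the nonempty vertex sets X spanning at least |X| edges, a minimal one
    yields a hypercircuit once exactly |X| of its edges are kept: if Y is a
    nonempty proper subset of X, the edges missing Y lie inside X \ Y, which by
    minimality spans fewer than |X \ Y| edges, so more than |Y| edges meet Y. *)
Require Import Defs.
From mathcomp Require Import all_boot.

Lemma exists_subset_of_card (T : finType) (A : {set T}) (k : nat) :
  k <= #|A| -> exists2 B : {set T}, B \subset A & #|B| = k.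
Proof.
(* The [k]-subsets of [A] are counted by a binomial coefficient, positive as [k <= #|A|]. *)
rewrite -bin_gt0 -cards_draws card_gt0 => /set0Pn[B].
by rewrite inE => /andP[sBA /eqP cardB]; exists B.
Qed.

Lemma minimal_dense_hypercircuit (T : finType) (C : hypergraph T) :
  vertices C != set0 -> #|vertices C| = #|edges C| ->
  (forall X : {set T}, X != set0 -> X \proper vertices C ->
     #|edges C ::&: X| < #|X|) ->
  hypercircuit C.
Proof.
move=> C_n0 cardC sparse; split=> // Y Y_n0 ltYC.
have sYC := proper_sub ltYC.
have missY : edges C :\: Gamma C Y \subset edges C ::&: (vertices C :\: Y).
  apply/subsetP=> e; rewrite !inE => /andP[+ eC].
  rewrite eC /= negbK subsetD setI_eq0 => ->.
  by have [_ ->] := edgesP eC.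
have ltD : vertices C :\: Y \proper vertices C.
  rewrite properEcard subsetDl /= cardsD (setIidPr sYC).
  by rewrite ltn_subrL !card_gt0 Y_n0.
have D_n0 : vertices C :\: Y != set0.
  by rewrite setD_eq0; case/andP: ltYC.
have := leq_ltn_trans (subset_leq_card missY) (sparse _ D_n0 ltD).
have sGE : Gamma C Y \subset edges C by apply/subsetP=> e; rewrite inE => /andP[].
(* Since [C] has as many edges as vertices, both differences subtract from the same number, so the
   larger one subtracts less. *)
rewrite !cardsD (setIidPr sGE) (setIidPr sYC) -cardC addn1 => lt_sub.
by rewrite ltnNge; apply: contraL lt_sub => leGY; rewrite -leqNgt leq_sub2l.
Qed.

Lemma hyperforest_card_edges_lt (T : finType) (F : hypergraph T) :
  hyperforest F -> vertices F != set0 -> #|edges F| < #|vertices F|.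
Proof.
move=> F_forest F_n0; rewrite ltnNge; apply/negP=> le_VE.
pose dense (X : {set T}) := (X != set0) && (#|X| <= #|edges F ::&: X|).
(* Every edge of [F] lies inside [vertices F], so the negated bound starts the descent. *)
have dense_VF : dense (vertices F).
  rewrite /dense F_n0 (leq_trans le_VE) //; apply/subset_leq_card/subsetP=> e eF.
  by rewrite inE eF; have [_ ->] := edgesP eF.
have [X /minsetP[/andP[X_n0 leX] minX] sXF] := minset_exists dense_VF.
have [E' sE'X cardE'] := exists_subset_of_card _ _ _ leX.
have E'P e : e \in E' -> e != set0 /\ e \subset X.
  by move/(subsetP sE'X); rewrite inE => /andP[/edgesP[-> _] ->].
apply: (F_forest (Hypergraph E'P)).
  by split=> //; apply: subset_trans sE'X _; apply/subsetP=> e; rewrite inE => /andP[].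
apply: minimal_dense_hypercircuit => //= Y Y_n0 /andP[sYX nsXY].
rewrite ltnNge; apply: contra nsXY => leY.
(* A dense [Y] inside [X] equals [X] by minimality, against properness; kept edges are edges of [F],
   so [leY] gives density. *)
suff /minX <- : dense Y by [].
rewrite /dense Y_n0 (leq_trans leY) //; apply/subset_leq_card/subsetP=> e.
rewrite !inE => /andP[/(subsetP sE'X) + ->].
by rewrite inE => /andP[->].
Qed.

Theorem theorem5 (T : finType) (H F : hypergraph T)
    (H_nonempty : vertices H != set0)
    (F_sub_H : subhypergraph F H)
    (F_forest : hyperforest F) :
  #|edges F| <= #|vertices H| - 1.
Proof.
have [sFH _] := F_sub_H.
(* The strict bound fails for [F] without vertices, but then [F] has no edges, as edges are
   nonempty. *)
have [F0 | F_n0] := eqVneq (vertices F) set0; last first.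
  (* [H_nonempty] keeps the subtraction from truncating. *)
  rewrite subn1 -ltnS prednK ?card_gt0 //.
  exact: leq_trans (hyperforest_card_edges_lt _ _ F_forest F_n0) (subset_leq_card sFH).
suff -> : edges F = set0 by rewrite cards0.
apply/setP=> e; rewrite inE; apply/negP=> /edgesP[e_n0].
by rewrite F0 subset0 (negPf e_n0).
Qed.
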